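(* (i) For every hypergraph $\mathcal{H}$, it holds that $$\tau^*(\mathcal{H})\le\tau_g^*(\mathcal{H})<2\tau^*(\mathcal{H})\qquad\text{and}\qquad \tau^*(\mathcal{H})\le{\tau_g^*}'(\mathcal{H})<2\tau^*(\mathcal{H})+1.$$ (ii) There is no universal constant $C$ with $\tau_g(\mathcal{H})\le C\cdot\tau_g^*(\mathcal{H})$ (for all hypergraphs $\mathcal{H}$), and not even with $\tau(\mathcal{H})\le C\cdot\tau_g^*(\mathcal{H})$ (for all hypergraphs $\mathcal{H}$). The same holds true for ${\tau_g^*}'(\mathcal{H})$ (in place of $\tau_g^*(\mathcal{H})$), too.
   Context: A hypergraph $\mathcal{H}=(V,\mathcal{E})$ has a finite vertex set $V$ and an edge set $\mathcal{E}\subseteq 2^V\setminus\{\emptyset\}$. A transversal is a set $T\subseteq V$ meeting every edge; $\tau(\mathcal{H})$ is the minimum size of a transversal. A fractional transversal is a function $f:V\to[0,1]$ with $\sum_{v\in E}f(v)\ge1$ for every $E\in\mathcal{E}$; $\tau^*(\mathcal{H})$ is the minimum of $|f|=\sum_{v\in V}f(v)$ over fractional transversals. Integer transversal game: Edge-hitter and Staller alternately choose a vertex; each chosen vertex must be contained in at least one previously uncovered edge (an edge is covered once one of its vertices has been chosen). The game is over when all edges are covered; its length is the number of vertices chosen. Edge-hitter minimizes and Staller maximizes the length. $\tau_g(\mathcal{H})$ is the length under optimal play when Edge-hitter starts. Fractional transversal game on $\mathcal{H}$: Edge-hitter and Staller take turns making moves and update a cover function $t:V\to[0,1]$, with $|t|=\sum_{v}t(v)$.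 The corresponding load function is $\ell:\mathcal{E}\to[0,1]$, $\ell(E)=\min\{1,\sum_{v\in E}t(v)\}$. The functions after the $i$-th move are $t_i,\ell_i$; initially $t_0\equiv0$, $\ell_0\equiv0$. The game is finished when $\ell\equiv1$. As long as $\ell\not\equiv1$, the next player performs a move, which is a finite or infinite sequence of submoves $(u_1,w_1),(u_2,w_2),\dots$, where $u_k\in V$ (repetitions allowed) and the weights $w_k$ are reals in $[0,1]$. It is required that $\sum_kw_k=1$ in each move except the last move of the game, where $\sum_kw_k\le1$ suffices. The $i$-th move must be legal: for every $k\ge1$ there is an edge $E\in\mathcal{E}$ with $u_k\in E$ and $\ell_{i-1}(E)+\sum_{1\le s\le k-1,\,u_s\in E}w_s+w_k\le1$. The function $t_i$ is obtained from $t_{i-1}$ by adding $w_k$ to the value at $u_k$ for every submove. The value $|\mathcal{G}|$ of a game is $|t_q|$ for the final cover function $t_q$. Edge-hitter wants it small, Staller wants it large. $\tau_g^*(\mathcal{H})$ is the infimum of all $a$ such that Edge-hitter has a strategy ensuring $|\mathcal{G}|\le a$ when Edge-hitter starts; ${\tau_g^*}'(\mathcal{H})$ is defined in the same way for the game in which Staller makes the first move.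
   Formalization: The strict bound τ_g^*(H) < 2τ^*(H) is stated only for hypergraphs with at least one edge, since for an edgeless hypergraph both sides are 0 and the strict inequality fails. *)

(* Defs.v *)
From HB Require Import structures.
From mathcomp Require Import all_boot all_order all_algebra.
From mathcomp Require Import all_classical all_reals all_analysis.

Set Implicit Arguments.
Unset Strict Implicit.
Unset Printing Implicit Defensive.

Import Order.TTheory GRing.Theory Num.Theory.
Local Open Scope classical_set_scope.
Local Open Scope ring_scope.

Record hypergraph (V : finType) := Hypergraph {
  edges :> {set {set V}};
  edges_neq0 : finset.set0 \notin edges }.

Section Transversals.
Variables (V : finType) (H : hypergraph V).

Definition transversal (T : {set V}) : bool :=
  [forall E in edges H, ~~ [disjoint T & E]].

(* The full vertex set is a transversal, since edges are nonempty; hence it is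
   a legitimate starting point for the minimum. *)
Definition tau : nat :=
  #|[arg min_(T < [set: V]%SET | transversal T) #|T| ]|.

Definition frac_transversal (R : realType) (f : V -> R) : Prop :=
  (forall v, 0 <= f v <= 1) /\
  (forall E, E \in edges H -> 1 <= \sum_(v in E) f v).

(* The infimum is a minimum: the fractional transversals form a nonempty
   compact set. *)
Definition tau_frac (R : realType) : R :=
  inf [set \sum_v f v | f in @frac_transversal R].

End Transversals.

Section IntegerGame.
Variables (V : finType) (H : hypergraph V).

Definition legal_vertex (S : {set V}) (v : V) : bool :=
  [exists E in edges H, (v \in E) && [disjoint S & E]].

(* Number of vertices still to be chosen under optimal play once the vertices
   of S have been chosen; [hitter] tells whether Edge-hitter is to move.  The
   argument n bounds the number of remaining moves.  A legal vertex is never in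
   S, so that n = #|V| suffices from the initial position.  The default value m
   of the minimum is an upper bound of the values it ranges over. *)
Fixpoint opt_length (n : nat) (hitter : bool) (S : {set V}) : nat :=
  if n is m.+1 then
    if transversal H S then 0%N
    else (if hitter
          then \big[minn/m]_(v | legal_vertex S v)
                 opt_length m false (v |: S)%SET
          else \max_(v | legal_vertex S v)
                 opt_length m true (v |: S)%SET).+1
  else 0%N.

Definition tau_game : nat := opt_length #|V| true finset.set0.

End IntegerGame.

Section FractionalGame.
Variables (V : finType) (R : realType) (H : hypergraph V).

(* A finite or an infinite sequence of submoves (u_k, w_k); indices start
   at 0. *)
Definition move : Type := (seq (V * R) + (nat -> V * R))%type.

Definition submove (m : move) (k : nat) : option (V * R) :=
  match m with inl s => onth s k | inr s => Some (s k) end.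

(* The weight w_k if the k-th submove exists and u_k is in A, and 0
   otherwise. *)
Definition weight_in (m : move) (A : {set V}) (k : nat) : R :=
  if submove m k is Some (u, w) then (if u \in A then w else 0) else 0.

(* The sum is taken in the extended reals, where a divergent sum of
   nonnegative weights is +oo. *)
Definition total_in (m : move) (A : {set V}) : \bar R :=
  (\sum_(0 <= k <oo) (weight_in m A k)%:E)%E.

Definition load (t : V -> R) (E : {set V}) : R :=
  Num.min 1 (\sum_(v in E) t v).

Definition finished (t : V -> R) : bool :=
  [forall E in edges H, load t E == 1].

Definition update (t : V -> R) (m : move) : V -> R :=
  fun v => t v + fine (total_in m [set v]%SET).

(* Together with the initial cover function being 0, legality keeps cover
   functions within [0, 1]. *)
Definition legal_move (t : V -> R) (m : move) : Prop :=
  [/\ forall k u w, submove m k = Some (u, w) ->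
        0 <= w <= 1 /\
        (exists E, [/\ E \in edges H, u \in E &
           load t E + \sum_(s < k) weight_in m E s + w <= 1]),
      (total_in m [set: V]%SET <= 1%:E)%E &
      total_in m [set: V]%SET = 1%:E \/ finished (update t m)].

(* A history is the list of the moves made so far, in chronological order. *)
Definition history : Type := seq move.

Definition cover (g : history) : V -> R := foldl update (fun=> 0) g.

Definition hitter_turn (hitter_first : bool) (g : history) : bool :=
  hitter_first (+) odd (size g).

Definition strategy : Type := history -> move.

Inductive plays (hitter_first : bool) (sigma : strategy) : history -> Prop :=
| plays_start : plays hitter_first sigma [::]
| plays_hitter g :
    plays hitter_first sigma g -> ~~ finished (cover g) ->
    hitter_turn hitter_first g ->
    plays hitter_first sigma (rcons g (sigma g))
| plays_staller g m :
    plays hitter_first sigma g -> ~~ finished (cover g) ->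
    ~~ hitter_turn hitter_first g -> legal_move (cover g) m ->
    plays hitter_first sigma (rcons g m).

(* Every play is finite: each move but the last adds exactly 1 to the sum of
   the cover function, which never exceeds #|V|.  Hence bounding the value of
   the finished plays is enough. *)
Definition ensures (hitter_first : bool) (sigma : strategy) (a : R) : Prop :=
  (forall g, plays hitter_first sigma g -> ~~ finished (cover g) ->
     hitter_turn hitter_first g -> legal_move (cover g) (sigma g)) /\
  (forall g, plays hitter_first sigma g -> finished (cover g) ->
     \sum_v cover g v <= a).

Definition frac_game_value (hitter_first : bool) : R :=
  inf [set a | exists sigma, ensures hitter_first sigma a].

End FractionalGame.

Definition tau_frac_game (V : finType) (H : hypergraph V) (R : realType) : R :=
  frac_game_value R H true.

Definition tau_frac_game' (V : finType) (H : hypergraph V) (R : realType) : R :=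
  frac_game_value R H false.

(* Main.v *)
Require Import Defs.
From mathcomp Require Import all_boot all_order all_algebra.
From mathcomp Require Import all_classical all_reals all_analysis.
From mathcomp Require Import lra zify.
Import Order.TTheory GRing.Theory Num.Theory.
Import numFieldNormedType.Exports.
Local Open Scope ring_scope.

(** Lower bounds.  When a fractional transversal game ends, the cover function
    is a fractional transversal, so its weight is at least tau*.  This bounds
    what a strategy can ensure once some play against it is known to end:
    Staller is never stuck (greedy_move), each move before the last adds exactly
    1, and cover functions stay below 1 (update_le1), so plays have bounded
    length (finished_play_exists).

    Upper bounds.  Edge-hitter fixes a fractional transversal f of minimum
    weight tau* (tau_frac_attained, by compactness) and only ever plays weight
    that f still provides.  The invariant is a residual r such that t + r covers
    every edge.  Moves of Staller only increase t, so they keep r valid;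
    Edge-hitter moves weight from r to t, each time some edge that is not full
    offering room, until one unit is spent or the game is over (greedy_seq).
    After p full moves of Edge-hitter the residual weighs at most tau* - p, so
    the game goes on only if p < tau*, and counting moves gives a final weight
    of at most p + tau*, or p + 1 + tau* when Staller starts
    (hitter_strategy_play).  As p is an integer, p <= ceil tau* - 1 < tau*, a
    bound independent of the play; this is what makes the inequalities strict
    for the infimum (game_lt_tau_frac).

    Ratios.  On 2k points, with all sets of at least k points as edges, tau
    exceeds k while tau* is at most 2, so both fractional game values are at
    most 5.  The vertices chosen in the integer game form a transversal, so
    tau_g is at least tau (tau_le_tau_game) and is unbounded as well. *)

Local Notation cover := Defs.cover.
Local Notation transversal := Defs.transversal.

(** * The minimum fractional transversal *)

Lemma edge_neq0 {V : finType} {H : hypergraph V} {E : {set V}} :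
  E \in edges H -> exists v, v \in E.
Proof.
by move=> EH; apply/set0Pn; apply: contraTneq EH => ->; exact: edges_neq0.
Qed.

Lemma prod_sum_continuous {V : finType} {R : realType} (P : pred V) :
  continuous (fun f : prod_topology (fun _ : V => R^o) => \sum_(v | P v) f v).
Proof.
elim: (index_enum V) => [|v s IH].
  by rewrite (_ : (fun _ => _) = cst 0); [exact: cst_continuous|
    apply/funext => f; rewrite big_nil].
have [Pv|nPv] := boolP (P v); last first.
  rewrite (_ : (fun _ => _) = fun f => \sum_(u <- s | P u) f u) //.
  by apply/funext => f; rewrite big_cons (negbTE nPv).
have cv : continuous (fun f : prod_topology (fun _ : V => R^o) => f v : R^o).
  exact: (@proj_continuous V (fun=> R^o) v).
move=> f; have := continuousD (cv f) (IH f).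
by congr continuous_at; apply/funext => g; rewrite big_cons Pv.
Qed.

Lemma tau_frac_le {V : finType} {R : realType} {H : hypergraph V} (f : V -> R) :
  frac_transversal H f -> tau_frac H R <= \sum_v f v.
Proof.
move=> fH; apply: ge_inf; last by exists f.
by exists 0 => _ [g [g01 _] <-]; apply: sumr_ge0 => v _; case/andP: (g01 v).
Qed.

(** The strict upper bounds on the game values need a fractional transversal
    of weight exactly tau*.  When tau* is an integer p, a heavier one would
    leave some of its weight unplayed after p full moves of Edge-hitter, and
    Staller could then add a further full move. *)
Lemma tau_frac_attained {V : finType} (H : hypergraph V) (R : realType) :
  exists2 f : V -> R, frac_transversal H f & \sum_v f v = tau_frac H R.
Proof.
set A : set (prod_topology (fun _ : V => R^o)) :=
  [set f : V -> R | frac_transversal H f]%classic.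
have AE : (A = [set f | forall v, `[0, 1]%classic (f v)] `&`
    \bigcap_(E in [set` edges H])
      [set f | (1 <= \sum_(v in E) f v)%R])%classic.
  by apply/seteqP; split => f /= [f01 fE]; split.
have cA : compact A.
  rewrite AE; apply: compact_closedI.
    apply: (@tychonoff V (fun=> R^o) (fun=> `[0, 1]%classic)) => _.
    exact: segment_compact.
  apply: closed_bigI => E _.
  apply: (@preimage_closed _ R^o _ [set y | 1 <= y]%classic).
    by move=> f _; exact: prod_sum_continuous.
  exact: closed_ge.
have A0 : (A !=set0)%classic.
  exists (fun=> 1); split=> [v|E EH]; first by rewrite ler01 lexx.
  have [v vE] := edge_neq0 EH.
  by rewrite (bigD1 v)//= lerDl; apply: sumr_ge0.
have [f /set_mem fA fmin] := compact_EVT_min A0 cA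
  (continuous_subspaceT (prod_sum_continuous predT)).
exists f => //; apply/eqP; rewrite eq_le (tau_frac_le f fA) andbT.
apply: lb_le_inf; first by exists (\sum_v f v), f.
by move=> _ [g gA <-]; apply: fmin; exact: mem_set.
Qed.

Lemma tau_frac_ge0 {V : finType} (R : realType) (H : hypergraph V) :
  0 <= tau_frac H R.
Proof.
have [f [f01 _] <-] := tau_frac_attained H R.
by apply: sumr_ge0 => v _; case/andP: (f01 v).
Qed.

Lemma tau_frac_ge1 {V : finType} (R : realType) (H : hypergraph V) :
  edges H <> finset.set0 -> 1 <= tau_frac H R.
Proof.
move=> /eqP/set0Pn[E EH]; have [f [f01 cov] <-] := tau_frac_attained H R.
apply: le_trans (cov _ EH) _; rewrite [leRHS](bigID (mem E)) /= lerDl.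
by apply: sumr_ge0 => v _; case/andP: (f01 v).
Qed.

(** * Cover functions after legal moves *)

Lemma finishedP {V : finType} {R : realType} {H : hypergraph V} {t : V -> R} :
  reflect (forall E, E \in edges H -> 1 <= \sum_(v in E) t v) (finished H t).
Proof.
apply: (iffP forall_inP) => h E /h; rewrite /load.
  by move/eqP => {1}<-; rewrite ge_min lexx orbT.
by move=> le1; apply/eqP/min_l.
Qed.

Lemma weight_in_ge0 {V : finType} {R : realType} {H : hypergraph V}
    {t : V -> R} {m : move V R} (A : {set V}) k :
  legal_move H t m -> 0 <= weight_in m A k.
Proof.
case=> legal _ _; rewrite /weight_in.
case e: (submove m k) => [[u w]|//]; case: ifP => // _.
by have [/andP[]] := legal _ _ _ e.
Qed.

Lemma weight_in_sum {V : finType} {R : realType} (m : move V R) (A : {set V}) k :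
  weight_in m A k = \sum_(v in A) weight_in m [set v]%SET k.
Proof.
rewrite /weight_in; case: (submove m k) => [[u w]|]; last by rewrite big1.
case: ifPn => uA.
  rewrite (bigD1 u)//= inE eqxx big1 ?addr0// => v /andP[_ vu].
  by rewrite inE eq_sym (negbTE vu).
rewrite big1// => v vA; rewrite inE; case: eqP => // uv.
by rewrite uv vA in uA.
Qed.

Lemma le_weight_in {V : finType} {R : realType} {H : hypergraph V}
    {t : V -> R} {m : move V R} {A B : {set V}} k :
  legal_move H t m -> A \subset B -> weight_in m A k <= weight_in m B k.
Proof.
move=> lm AB; have := weight_in_ge0 B k lm; rewrite /weight_in.
case: (submove m k) => [[u w]|//].
by have [uA|] := boolP (u \in A) => //; rewrite (fintype.subsetP AB _ uA).
Qed.

Lemma total_in_sum {V : finType} {R : realType} {H : hypergraph V}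
    {t : V -> R} {m : move V R} (A : {set V}) :
  legal_move H t m ->
  total_in m A = (\sum_(v in A) total_in m [set v]%SET)%E.
Proof.
move=> lm; rewrite /total_in -nneseries_sum; last first.
  by move=> v k _; rewrite lee_fin (weight_in_ge0 _ _ lm).
by apply: eq_eseriesr => k _; rewrite weight_in_sum sumEFin.
Qed.

Lemma total_in_ge0 {V : finType} {R : realType} {H : hypergraph V}
    {t : V -> R} {m : move V R} (A : {set V}) :
  legal_move H t m -> (0%:E <= total_in m A)%E.
Proof.
by move=> lm; apply: nneseries_ge0 => k _ _; rewrite lee_fin (weight_in_ge0 _ _ lm).
Qed.

Lemma total_in_fin {V : finType} {R : realType} {H : hypergraph V}
    {t : V -> R} {m : move V R} (A : {set V}) :
  legal_move H t m -> total_in m A \is a fin_num.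
Proof.
move=> lm; have [_ le1 _] := lm.
rewrite ge0_fin_numE ?(total_in_ge0 _ lm)//.
apply: (@le_lt_trans _ _ 1%:E); last exact: ltry.
apply: le_trans le1; apply: lee_nneseries => k *.
  by rewrite lee_fin (weight_in_ge0 _ _ lm).
by rewrite lee_fin (le_weight_in _ lm)// finset.subsetT.
Qed.

Lemma sum_update {V : finType} {R : realType} {H : hypergraph V}
    {t : V -> R} {m : move V R} (A : {set V}) :
  legal_move H t m ->
  \sum_(v in A) update t m v = \sum_(v in A) t v + fine (total_in m A).
Proof.
move=> lm; rewrite big_split /=; congr (_ + _).
by rewrite (total_in_sum A lm) -sum_fine// => v _; exact: (total_in_fin _ lm).
Qed.

Lemma le_update {V : finType} {R : realType} {H : hypergraph V}
    {t : V -> R} {m : move V R} (v : V) :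
  legal_move H t m -> t v <= update t m v.
Proof. by move=> lm; rewrite lerDl fine_ge0// (total_in_ge0 _ lm). Qed.

Lemma mass_update {V : finType} {R : realType} {H : hypergraph V}
    {t : V -> R} {m : move V R} :
  legal_move H t m ->
  \sum_v update t m v = \sum_v t v + fine (total_in m [set: V]%SET).
Proof.
move=> lm; have := sum_update [set: V]%SET lm.
have inT (F : V -> R) : \sum_(v in [set: V]%SET) F v = \sum_v F v.
  by apply: eq_bigl => v; rewrite inE.
by rewrite !inT.
Qed.

Lemma mass_update_le {V : finType} {R : realType} {H : hypergraph V}
    {t : V -> R} {m : move V R} :
  legal_move H t m -> \sum_v update t m v <= \sum_v t v + 1.
Proof.
move=> lm; rewrite (mass_update lm).
rewrite lerD2l -lee_fin fineK ?(total_in_fin _ lm)//.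
by case: lm.
Qed.

Lemma mass_update_unfinished {V : finType} {R : realType} {H : hypergraph V}
    {t : V -> R} {m : move V R} :
  legal_move H t m -> ~~ finished H (update t m) ->
  \sum_v update t m v = \sum_v t v + 1.
Proof.
move=> lm unfin; rewrite (mass_update lm).
by case: lm => _ _ [-> //|fin]; rewrite fin in unfin.
Qed.

(** The reason why every play is finite: the mass of the cover function grows
    by one in each move before the last, and stays below #|V|. *)
Lemma update_le1 {V : finType} {R : realType} {H : hypergraph V}
    {t : V -> R} {m : move V R} :
  legal_move H t m -> (forall v, 0 <= t v <= 1) ->
  forall v, update t m v <= 1.
Proof.
move=> lm t01 v; have [legal _ _] := lm.
(* Positive weight is put on v only while some edge through v is not yet
   full, and that edge carries at least the value at v. *)
have part n : \sum_(k < n) weight_in m [set v]%SET k <= 1 - t v.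
  elim: n => [|n IH]; first by rewrite big_ord0 subr_ge0; case/andP: (t01 v).
  rewrite big_ord_recr /= {2}/weight_in.
  case e: (submove m n) => [[u w]|]; last by rewrite addr0.
  rewrite inE; case: eqP => [uv|_]; last by rewrite addr0.
  have [_ [E [EH uE le1]]] := legal _ _ _ e; rewrite uv in uE.
  have tle : t v <= load t E.
    rewrite le_min; have /andP[_ ->] := t01 v; rewrite (bigD1 v)//= lerDl.
    by apply: sumr_ge0 => x _; case/andP: (t01 x).
  have : \sum_(k < n) weight_in m [set v]%SET k <= \sum_(k < n) weight_in m E k.
    by apply: ler_sum => k _; apply: (le_weight_in _ lm); rewrite finset.sub1set.
  by lra.
rewrite /update -lerBrDl -lee_fin fineK ?(total_in_fin _ lm)//.
apply: lime_le.
  by apply: is_cvg_nneseries => k _ _; rewrite lee_fin (weight_in_ge0 _ _ lm).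
by apply: nearW => n; rewrite sumEFin lee_fin big_mkord.
Qed.

(** * Greedy moves *)

Definition added {V : finType} {R : realType} (s : seq (V * R)) (A : {set V}) : R :=
  \sum_(x <- s) (if x.1 \in A then x.2 else 0).

Lemma added_sum {V : finType} {R : realType} (s : seq (V * R)) (A : {set V}) :
  added s A = \sum_(v in A) added s [set v]%SET.
Proof.
rewrite /added exchange_big; apply: eq_bigr => x _ /=.
case: ifPn => xA.
  rewrite (bigD1 x.1)//= inE eqxx big1 ?addr0// => v /andP[_ vu].
  by rewrite inE eq_sym (negbTE vu).
rewrite big1// => v vA; rewrite inE; case: eqP => // uv.
by rewrite uv vA in xA.
Qed.

(** The prefix form matches the legality condition, where the k-th submove is
    tested against the weights of the submoves before it. *)
Lemma sum_weight_in_seq {V : finType} {R : realType} (s : seq (V * R))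
    (A : {set V}) n :
  \sum_(k < n) weight_in (inl s) A k = added (take n s) A.
Proof.
elim: s n => [|x s IH] n.
  by rewrite /added big_nil big1// => k _; rewrite /weight_in /= onth0n.
case: n => [|n]; first by rewrite big_ord0 /added big_nil.
rewrite big_ord_recl /= /added big_cons -/(added _ _) -IH.
by congr (_ + _); case: x.
Qed.

Lemma total_in_seq {V : finType} {R : realType} (s : seq (V * R))
    (A : {set V}) :
  total_in (inl s) A = (added s A)%:E.
Proof.
apply: lim_near_cst => //; near=> n.
rewrite sumEFin big_mkord sum_weight_in_seq take_oversize//.
by near: n; exact: nbhs_infty_ge.
Unshelve. all: by end_near.
Qed.

Lemma update_seq {V : finType} {R : realType} (t : V -> R) (s : seq (V * R)) v :
  update t (inl s) v = t v + added s [set v]%SET.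
Proof. by rewrite /update total_in_seq. Qed.

(** Greedy filling: as long as some edge E is not full, part of the residual r
    lies inside E, so some v in E with r v > 0 can receive
    c = min (r v) (1 - t(E)), which is legal because of E.  This exhausts either
    the residual at v or the free space of E, so the number of edges that are
    not full plus the size of the support of r drops.  The weight goes from r to
    t, hence t + r keeps covering every edge. *)
Lemma greedy_seq {V : finType} {R : realType} (H : hypergraph V) (n : nat)
    (t r : V -> R) (b : R) :
  (#|[set E in edges H | (\sum_(v in E) t v < 1)%R]%SET|
    + #|[set v | (r v != 0)%R]%SET| <= n)%N ->
  0 <= b <= 1 -> (forall v, 0 <= r v) ->
  (forall E, E \in edges H -> 1 <= \sum_(v in E) (t v + r v)) ->
  exists s : seq (V * R), [/\
    forall k u w, onth s k = Some (u, w) -> 0 <= w <= 1 /\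
      (exists E, [/\ E \in edges H, u \in E &
         \sum_(v in E) t v + added (take k s) E + w <= 1]),
    forall v, added s [set v]%SET <= r v,
    added s [set: V]%SET <= b &
    added s [set: V]%SET = b \/
    forall E, E \in edges H -> 1 <= \sum_(v in E) t v + added s E].
Proof.
elim: n t r b => [|n IH] t r b meas /andP[b0 b1] r0 cov;
    have [allsat|] := pselect (forall E, E \in edges H -> 1 <= \sum_(v in E) t v).
- exists [::]; rewrite /added; split=> [k u w|v||]; rewrite ?onth0n ?big_nil//.
  by right=> E EH; rewrite big_nil addr0 allsat.
- case=> E EH; rewrite leNgt; apply/negP => Elt.
  move: meas; rewrite leqn0 addn_eq0 cards_eq0 => /andP[/eqP/setP/(_ E)].
  by rewrite !inE EH Elt.
- exists [::]; rewrite /added; split=> [k u w|v||]; rewrite ?onth0n ?big_nil//.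
  by right=> E EH; rewrite big_nil addr0 allsat.
move=> /existsNP[E /not_implyP[EH /negP]]; rewrite -ltNge => Elt.
have [v vE rv] : exists2 v, v \in E & r v != 0.
  apply: contrapT => no; have := cov _ EH; rewrite leNgt => /negP; apply.
  rewrite (eq_bigr t)// => v vE; have [->|rv] := eqVneq (r v) 0.
    by rewrite addr0.
  by case: no; exists v.
have rv0 : 0 < r v by rewrite lt0r rv r0.
set c := Num.min (r v) (1 - \sum_(u in E) t u).
have c0 : 0 < c by rewrite lt_min rv0 subr_gt0.
have cr : c <= r v by rewrite ge_min lexx.
have cE : c <= 1 - \sum_(u in E) t u by rewrite ge_min lexx orbT.
(* When the budget b runs out first, a single submove of weight b is enough. *)
have [bc|cb] := leP b c.
  exists [:: (v, b)]; rewrite /added; split=> [k u w|u||]; rewrite ?big_seq1 ?inE//=.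
  - case: k => [|k]; last by rewrite /= onth0n.
    move=> [<- <-]; split; first exact/andP.
    by exists E; split=> //; rewrite take0 big_nil addr0; lra.
  - by case: eqP => [<-|]; rewrite ?r0// (le_trans bc).
  - by left.
pose d u := if v == u then c else 0.
have dE (A : {set V}) : \sum_(u in A) d u = if v \in A then c else 0.
  case: ifPn => vA.
    by rewrite (bigD1 v)//= /d eqxx big1 ?addr0// => u /andP[_ /negbTE]; rewrite eq_sym => ->.
  by rewrite big1// => u uA; rewrite /d; case: eqP => // vu; rewrite vu uA in vA.
have d0 u : 0 <= d u by rewrite /d; case: ifP => // _; exact: ltW.
have [||u||s [legal sr sb sfin]] := IH (fun u => t u + d u) (fun u => r u - d u) (b - c).
- rewrite -ltnS; apply: leq_trans meas.
  have subE : [set F in edges H | \sum_(u in F) (t u + d u) < 1]%SET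
      \subset [set F in edges H | \sum_(u in F) t u < 1]%SET.
    apply/fintype.subsetP => F; rewrite !inE => /andP[-> /le_lt_trans]; apply.
    by apply: ler_sum => u _; rewrite lerDl.
  have subr : [set u | r u - d u != 0]%SET \subset [set u | r u != 0]%SET.
    apply/fintype.subsetP => u; rewrite !inE /d.
    by case: (v =P u) => [<- //|_]; rewrite subr0.
  have [rle|rgt] := leP (r v) (1 - \sum_(u in E) t u).
    rewrite -addnS; apply: leq_add; first exact: subset_leq_card.
    apply: proper_card; apply/properP; split=> //; exists v; rewrite inE//.
    by rewrite /d eqxx /c (min_idPl rle) subrr eqxx.
  rewrite -addSn; apply: leq_add; last exact: subset_leq_card.
  apply: proper_card; apply/properP; split=> //; exists E; rewrite inE EH//.
  by rewrite big_split /= dE vE /c (min_idPr (ltW rgt)) addrC subrK ltxx.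
- by lra.
- by rewrite /d subr_ge0; case: (v =P u) => [<-|].
- by move=> F FH; under eq_bigr do rewrite addrACA subrr addr0 ; exact: cov.
have addedE s' (A : {set V}) :
    added ((v, c) :: s') A = \sum_(u in A) d u + added s' A.
  by rewrite /added big_cons dE.
exists ((v, c) :: s); split.
- case=> [|k] u w /=.
    move=> [<- <-]; split; first by lra.
    by exists E; split=> //; rewrite /added big_nil addr0; lra.
  move=> /legal[-> [F [FH uF le1]]]; split=> //; exists F; split=> //.
  by move: le1; rewrite addedE big_split /= !addrA.
- by move=> u; rewrite addedE big_set1 addrC -lerBrDr; exact: sr.
- by rewrite addedE dE inE -lerBrDl.
- case: sfin => [sE|sat]; [left|right].
    by rewrite addedE dE inE sE addrC subrK.
  by move=> F /sat; rewrite addedE big_split /= addrA.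
Qed.

(** If t + r covers, a legal move can be played inside r; what remains of the
    residual, t + r - update t m, still completes the new cover function.  For
    Edge-hitter r is what is left of a fractional transversal; with r = 1 the
    lemma shows that no player is ever stuck. *)
Lemma greedy_move {V : finType} {R : realType} (H : hypergraph V) (t r : V -> R) :
  (forall v, 0 <= r v) ->
  (forall E, E \in edges H -> 1 <= \sum_(v in E) (t v + r v)) ->
  exists2 m, legal_move H t m & forall v, update t m v <= t v + r v.
Proof.
move=> r0 cov.
have [|s [legal sr sb sfin]] := greedy_seq H _ t r 1 (leqnn _) _ r0 cov.
  by rewrite ler01 lexx.
exists (inl s); last by move=> v; rewrite update_seq lerD2l.
split.
- move=> k u w /legal[w01 [E [EH uE le1]]]; split=> //; exists E; split=> //.
  rewrite sum_weight_in_seq; apply: le_trans le1.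
  by rewrite !lerD2r ge_min lexx orbT.
- by rewrite total_in_seq lee_fin.
- case: sfin => [sE|sat]; [left|right]; first by rewrite total_in_seq sE.
  apply/finishedP => E /sat; under [in X in _ -> X]eq_bigr do rewrite update_seq.
  by rewrite big_split /= -added_sum.
Qed.

(** * Plays and their lower bound *)

Lemma cover_rcons {V : finType} {R : realType} (g : history V R) m :
  cover (rcons g m) = update (cover g) m.
Proof. by rewrite /cover foldl_rcons. Qed.

Lemma play_cover {V : finType} {R : realType} {H : hypergraph V} {hf : bool}
    {sigma : strategy V R} {g : history V R} :
  (forall g, plays H hf sigma g -> ~~ finished H (cover g) ->
     hitter_turn hf g -> legal_move H (cover g) (sigma g)) ->
  plays H hf sigma g ->
  (forall v, 0 <= cover g v <= 1) /\
  (~~ finished H (cover g) -> \sum_v cover g v = (size g)%:R).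
Proof.
move=> legal; have step (h : history V R) m : legal_move H (cover h) m ->
    ~~ finished H (cover h) ->
    (forall v, 0 <= cover h v <= 1) /\
    (~~ finished H (cover h) -> \sum_v cover h v = (size h)%:R) ->
    (forall v, 0 <= cover (rcons h m) v <= 1) /\
    (~~ finished H (cover (rcons h m)) ->
     \sum_v cover (rcons h m) v = (size (rcons h m))%:R).
  move=> lm unfin [h01 hsum]; rewrite cover_rcons size_rcons; split=> [v|unfin'].
    rewrite (update_le1 lm h01) andbT (le_trans _ (le_update v lm))//.
    by case/andP: (h01 v).
  by rewrite (mass_update_unfinished lm unfin') hsum// natr1.
elim=> [|h ph IH unfin turn|h m ph IH unfin _ lm].
- by split=> [v|_]; rewrite ?lexx ?ler01// big1.
- exact: (step _ _ (legal _ ph unfin turn) unfin IH).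
- exact: (step _ _ lm unfin IH).
Qed.

(** An unfinished play can always be continued, Staller using a greedy move, and
    its length is the mass of its cover function, which is at most #|V|. *)
Lemma finished_play_exists {V : finType} {R : realType} {H : hypergraph V}
    {hf : bool} {sigma : strategy V R} :
  (forall g, plays H hf sigma g -> ~~ finished H (cover g) ->
     hitter_turn hf g -> legal_move H (cover g) (sigma g)) ->
  exists2 g, plays H hf sigma g & finished H (cover g).
Proof.
move=> legal; apply: contrapT => nofin.
have unfin g : plays H hf sigma g -> ~~ finished H (cover g).
  by move=> pg; apply/negP => fin; apply: nofin; exists g.
have play_of n : exists2 g, plays H hf sigma g & size g = n.
  elim: n => [|n [g pg sz]]; first by exists [::] => //; exact: plays_start.
  have [turn|turn] := boolP (hitter_turn hf g).
    exists (rcons g (sigma g)); last by rewrite size_rcons sz.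
    exact: plays_hitter (unfin _ pg) turn.
  have [|E EH|m lm _] := greedy_move H (cover g) (fun=> 1).
  - by move=> _; exact: ler01.
  - have [v vE] := edge_neq0 EH; have [g01 _] := play_cover legal pg.
    rewrite (bigD1 v)//= -[leLHS]addr0; apply: lerD.
      by rewrite lerDr; case/andP: (g01 v).
    by apply: sumr_ge0 => u _; apply: addr_ge0 => //; case/andP: (g01 u).
  exists (rcons g m); last by rewrite size_rcons sz.
  exact: plays_staller (unfin _ pg) turn lm.
have [g pg sz] := play_of #|V|.+1.
have [g01 mass] := play_cover legal pg.
have := mass (unfin _ pg); rewrite sz => massE.
have : \sum_v cover g v <= #|V|%:R.
  rewrite -sum1_card natr_sum; apply: ler_sum => v _.
  by case/andP: (g01 v).
by rewrite massE ler_nat ltnn.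
Qed.

(** The final cover function of any play is a fractional transversal. *)
Lemma tau_frac_le_ensured {V : finType} {R : realType} (H : hypergraph V)
    (hf : bool) (sigma : strategy V R) (a : R) :
  ensures H hf sigma a -> tau_frac H R <= a.
Proof.
move=> [legal bound]; have [g pg fin] := finished_play_exists legal.
apply: le_trans (bound _ pg fin); apply: tau_frac_le; split; first by case: (play_cover legal pg).
exact/finishedP.
Qed.

(** * The strategy of Edge-hitter *)

(** The invariant of Edge-hitter is a residual r such that t + r covers, of
    total weight at most c.  The last clause treats two cases at once: a full
    move lowers the bound on the residual from c to c - 1, and a final move, of
    any weight, leaves a cover function of mass at most the old mass plus c. *)
Definition good_reply {V : finType} {R : realType} (H : hypergraph V)
    (c : R) (t : V -> R) (m : move V R) : Prop :=
  legal_move H t m /\ exists r : V -> R, [/\ forall v, 0 <= r v,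
    forall E, E \in edges H -> 1 <= \sum_(v in E) (update t m v + r v) &
    \sum_v update t m v + \sum_v r v <= \sum_v t v + c].

(** The number of moves that Edge-hitter has made in the history g. *)
Definition hitter_moves {V : finType} {R : realType} (hf : bool)
  (g : history V R) : nat := (size g + hf)./2.

Definition hitter_strategy {V : finType} (R : realType) (H : hypergraph V)
    (hf : bool) : strategy V R := fun g =>
  xget (inl [::]) (good_reply H (tau_frac H R - (hitter_moves hf g)%:R) (cover g)).

Lemma good_reply_exists {V : finType} {R : realType} {H : hypergraph V}
    {c : R} {t r : V -> R} :
  (forall v, 0 <= r v) -> \sum_v r v <= c ->
  (forall E, E \in edges H -> 1 <= \sum_(v in E) (t v + r v)) ->
  exists m, good_reply H c t m.
Proof.
move=> r0 rc cov; have [m lm le] := greedy_move H t r r0 cov.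
exists m; split=> //; exists (fun v => t v + r v - update t m v); split.
- by move=> v; rewrite subr_ge0.
- by move=> E EH; under eq_bigr do rewrite addrC subrK; exact: cov.
- by rewrite -big_split /=; under eq_bigr do rewrite addrC subrK;
    rewrite big_split lerD2l.
Qed.

Lemma hitter_turnE {V : finType} {R : realType} (hf : bool) (g : history V R) :
  (size g + hf)%N = (hitter_turn hf g + (hitter_moves hf g).*2)%N.
Proof.
by rewrite -{1}(odd_double_half (size g + hf)) /hitter_turn oddD oddb addbC.
Qed.

(** With p moves of Edge-hitter made and the game not over, the residual has
    weight at most tau* - p, and it is not 0, so p < tau* and p <= q.  If
    Edge-hitter then ends the game, the final mass is at most the number of
    moves so far, 2p (2p + 1 when Staller started), plus tau* - p; if Staller
    ends it, the final mass is at most 2p (resp. 2p + 1), which is again at most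
    p + tau* (resp. p + tau* + 1). *)
Lemma hitter_strategy_play {V : finType} {R : realType} (H : hypergraph V)
    (hf : bool) (q : R) (g : history V R) :
  (forall p : nat, p%:R < tau_frac H R -> p%:R <= q) ->
  0 <= q + tau_frac H R + (~~ hf)%:R ->
  plays H hf (hitter_strategy R H hf) g ->
  if finished H (cover g)
  then (\sum_v cover g v <= q + tau_frac H R + (~~ hf)%:R : Prop)
  else \sum_v cover g v = (size g)%:R /\
    exists r : V -> R, [/\ forall v, 0 <= r v,
      forall E, E \in edges H -> 1 <= \sum_(v in E) (cover g v + r v) &
      \sum_v r v <= tau_frac H R - (hitter_moves hf g)%:R].
Proof.
move=> qP bound0; set T := tau_frac H R in qP bound0 *.
(* A residual of weight 0 would mean that the game is over. *)
have lt_moves h (r : V -> R) : ~~ finished H (cover h) ->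
    (forall v, 0 <= r v) ->
    (forall E, E \in edges H -> 1 <= \sum_(v in E) (cover h v + r v)) ->
    \sum_v r v <= T - (hitter_moves hf h)%:R -> (hitter_moves hf h)%:R < T.
  move=> unfin r0 cov rsum; rewrite -subr_gt0 ltNge; apply: contra unfin => le0.
  have /psumr_eq0P r_eq0 : \sum_v r v = 0.
    by apply/eqP; rewrite eq_le (le_trans rsum le0) sumr_ge0.
  apply/finishedP => E /cov; rewrite (eq_bigr (cover h))// => v _.
  by rewrite r_eq0 ?addr0.
have turnE h := congr1 (fun n => n%:R : R) (@hitter_turnE V R hf h).
have hfE : (~~ hf)%:R = 1 - hf%:R :> R by case: (hf); rewrite ?subrr ?subr0.
elim=> [|h ph IH unfin turn|h m ph IH unfin turn lm].
- have c0 : \sum_v cover ([::] : history V R) v = 0 by rewrite big1.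
  case: ifP => _; rewrite c0//; split=> //.
  have [f [f01 cov] fT] := tau_frac_attained H R.
  exists f; split=> [v|E EH|].
  + by case/andP: (f01 v).
  + by under eq_bigr do rewrite add0r; exact: cov.
  + by rewrite /hitter_moves add0n (_ : hf./2 = 0%N) ?subr0 ?fT//; case: (hf).
- move: IH; rewrite (negbTE unfin) => -[mass [r [r0 cov rsum]]].
  have pT := lt_moves _ _ unfin r0 cov rsum; have pq := qP _ pT.
  have [lm [r' [r'0 cov' le]]] : good_reply H (T - (hitter_moves hf h)%:R)
      (cover h) (hitter_strategy R H hf h).
    by apply: (xgetPex (inl [::])); exact: (good_reply_exists r0 rsum cov).
  have := turnE h; rewrite turn !natrD -addnn natrD /= mulr1n => sizeE.
  rewrite cover_rcons; case: ifPn => [fin|unfin'].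
    have r'sum : 0 <= \sum_v r' v by apply: sumr_ge0.
    by rewrite hfE; lra.
  have mass' := mass_update_unfinished lm unfin'.
  rewrite size_rcons -natr1 mass' mass; split=> //; exists r'; split=> //.
  have -> : hitter_moves hf (rcons h (hitter_strategy R H hf h))
      = (hitter_moves hf h).+1.
    by have := hitter_turnE hf h; rewrite turn /hitter_moves size_rcons; lia.
  by rewrite -natr1; lra.
- move: IH; rewrite (negbTE unfin) => -[mass [r [r0 cov rsum]]].
  have pT := lt_moves _ _ unfin r0 cov rsum; have pq := qP _ pT.
  have := turnE h; rewrite (negbTE turn) !natrD -addnn natrD /= mulr0n => sizeE.
  rewrite cover_rcons; case: ifPn => [fin|unfin'].
    by have := mass_update_le lm; rewrite hfE; lra.
  have mass' := mass_update_unfinished lm unfin'.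
  rewrite size_rcons -natr1 mass' mass; split=> //; exists r; split=> //.
    move=> E EH; apply: le_trans (cov _ EH) _; apply: ler_sum => v _.
    by rewrite lerD2r (le_update v lm).
  have -> // : hitter_moves hf (rcons h m) = hitter_moves hf h.
  have := hitter_turnE hf h.
  by rewrite (negbTE turn) /hitter_moves size_rcons; lia.
Qed.

Lemma hitter_strategy_ensures {V : finType} {R : realType} (H : hypergraph V)
    (hf : bool) (q : R) :
  (forall p : nat, p%:R < tau_frac H R -> p%:R <= q) ->
  0 <= q + tau_frac H R + (~~ hf)%:R ->
  ensures H hf (hitter_strategy R H hf) (q + tau_frac H R + (~~ hf)%:R).
Proof.
move=> qP bound0; split=> g pg => [unfin turn|fin];
  have := hitter_strategy_play _ _ _ _ qP bound0 pg; last by rewrite fin.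
rewrite (negbTE unfin) => -[_ [r [r0 cov rsum]]].
suff [] : good_reply H (tau_frac H R - (hitter_moves hf g)%:R)
  (cover g) (hitter_strategy R H hf g) by [].
by apply: (xgetPex (inl [::])); exact: (good_reply_exists r0 rsum cov).
Qed.

(** * Bounds on the fractional game values *)

Lemma tau_frac_le_game {V : finType} (R : realType) (H : hypergraph V)
    (hf : bool) :
  tau_frac H R <= frac_game_value R H hf.
Proof.
apply: lb_le_inf; last by move=> a [sigma]; exact: tau_frac_le_ensured.
(* An infimum over the empty set would be 0, so some value must be shown to
   be ensured; the crude choice q = tau* suffices. *)
exists (tau_frac H R + tau_frac H R + (~~ hf)%:R).
exists (hitter_strategy R H hf); apply: hitter_strategy_ensures.
  by move=> p /ltW.
by rewrite !addr_ge0 ?tau_frac_ge0.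
Qed.

(** The integers below tau* are at most q = ceil tau* - 1, and q itself is
    strictly below tau*; so the ensured value q + tau* (+ 1 when Staller
    starts) is strictly below the bound, uniformly in the play. *)
Lemma game_lt_tau_frac {V : finType} (R : realType) (H : hypergraph V)
    (hf : bool) :
  (hf -> edges H <> finset.set0) ->
  frac_game_value R H hf < 2 * tau_frac H R + (~~ hf)%:R.
Proof.
move=> nontriv; pose q : R := (Num.ceil (tau_frac H R) - 1)%:~R.
have qT : q < tau_frac H R by exact: ceilB1_lt.
have qP (p : nat) : p%:R < tau_frac H R -> p%:R <= q.
  by rewrite -[p%:R]/(p%:~R) -ceil_gt_int ler_int lerBrDr lezD1.
have bound0 : 0 <= q + tau_frac H R + (~~ hf)%:R.
  have T0 := tau_frac_ge0 R H.
  case: hf nontriv => [/(_ isT) ne|_].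
    rewrite addr0 addr_ge0//; apply: (qP 0%N).
    by rewrite (lt_le_trans ltr01)// tau_frac_ge1.
  have : -1 <= q.
    by rewrite /q intrD lerDr ler0z ceil_ge0 (lt_le_trans _ T0)// ltrN10.
  by move=> ? /=; lra.
apply: (@le_lt_trans _ _ (q + tau_frac H R + (~~ hf)%:R)); last first.
  by rewrite ltrD2r mulr_natl mulr2n ltrD2r.
apply: ge_inf.
  by exists (tau_frac H R) => a [sigma]; exact: tau_frac_le_ensured.
by exists (hitter_strategy R H hf); exact: hitter_strategy_ensures.
Qed.

(** * Integer transversals and unbounded ratios *)

Lemma transversalT {V : finType} (H : hypergraph V) :
  transversal H [set: V]%SET.
Proof.
apply/forall_inP => E EH; have [v vE] := edge_neq0 EH.
by apply/pred0Pn; exists v; rewrite /= inE.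
Qed.

Lemma tau_le_transversal {V : finType} (H : hypergraph V) (T : {set V}) :
  transversal H T -> (tau H <= #|T|)%N.
Proof.
move=> trT; rewrite /tau; case: arg_minnP => [|T0 _]; last exact.
exact: transversalT.
Qed.

Lemma transversalPn {V : finType} {H : hypergraph V} {S : {set V}} :
  ~~ transversal H S -> exists v, legal_vertex H S v.
Proof.
move=> /forall_inPn[E EH]; rewrite negbK => disj; have [v vE] := edge_neq0 EH.
by exists v; apply/exists_inP; exists E => //; rewrite vE.
Qed.

Lemma legal_vertex_notin {V : finType} {H : hypergraph V} {S : {set V}} {v : V} :
  legal_vertex H S v -> v \notin S.
Proof.
move=> /exists_inP[E _ /andP[vE]]; rewrite disjoint_sym => /disjointFr.
by move=> /(_ _ vE) ->.
Qed.

(** Chosen vertices form a transversal when the game ends.  The bound on n says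
    that at least as many moves are allowed as vertices remain, so the cut-off
    at n = 0 and the default value of the minimum do no harm. *)
Lemma tau_le_opt_length {V : finType} (H : hypergraph V) (n : nat)
    (hitter : bool) (S : {set V}) :
  (#|V| <= n + #|S|)%N -> (tau H <= opt_length H n hitter S + #|S|)%N.
Proof.
have tauV : (tau H <= #|V|)%N.
  by rewrite -cardsT; apply: tau_le_transversal; exact: transversalT.
elim: n hitter S => [|n IH] hitter S /= le; first exact: leq_trans tauV le.
case: ifPn => [/tau_le_transversal//|ntr].
have next b v : legal_vertex H S v ->
    (tau H <= (opt_length H n b (v |: S)%SET).+1 + #|S|)%N.
  move=> /legal_vertex_notin vS; have := IH b (v |: S)%SET.
  by rewrite cardsU1 vS add1n !addnS; apply.
case: hitter.
  elim/big_ind: _ => [|x y|v]; [exact: leq_trans tauV le|by rewrite /minn; case: ifP|exact: next].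
have [v lv] := transversalPn ntr.
apply: leq_trans (next true v lv) _; rewrite leq_add2r ltnS.
exact: leq_bigmax_cond.
Qed.

Lemma tau_le_tau_game {V : finType} (H : hypergraph V) :
  (tau H <= tau_game H)%N.
Proof.
by have := tau_le_opt_length H #|V| true finset.set0; rewrite cards0 !addn0; apply.
Qed.

Lemma large_sets_neq0 (k : nat) :
  finset.set0 \notin [set E : {set 'I_(k.+1.*2)} | (k.+1 <= #|E|)%N]%SET.
Proof. by rewrite inE cards0. Qed.

(** On 2(k+1) points, all sets with at least half of the points.  A set of at
    most k + 1 points misses its complement, which is an edge, so tau > k + 1,
    while the constant 1/(k+1) is a fractional transversal of weight 2. *)
Definition large_sets (k : nat) : hypergraph 'I_(k.+1.*2) :=
  Hypergraph (large_sets_neq0 k).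

Lemma tau_large_sets (k : nat) : (k.+1 < tau (large_sets k))%N.
Proof.
rewrite /tau; case: arg_minnP => [|T trT _]; first exact: transversalT.
rewrite ltnNge; apply/negP => le; move/forall_inP: trT => /(_ (~: T)%SET).
rewrite inE cardsCs finset.setCK card_ord; move=> /(_ _)/negP; apply.
  by lia.
by rewrite -setI_eq0 finset.setICr.
Qed.

Lemma tau_frac_large_sets (R : realType) (k : nat) :
  tau_frac (large_sets k) R <= 2.
Proof.
have k0 : 0 < k.+1%:R :> R by rewrite ltr0n.
have fH : frac_transversal (large_sets k) (fun=> k.+1%:R^-1 : R).
  split=> [v|E]; first by rewrite invr_ge0 ltW//= invf_le1// ler1n.
  by rewrite inE sumr_const -[_ *+ #|E|]mulr_natl ler_pdivlMr// mul1r ler_nat.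
apply: le_trans (tau_frac_le _ fH) _.
by rewrite sumr_const card_ord -[_ *+ _.*2]mulr_natl -mul2n natrM mulfK ?gt_eqF.
Qed.

Lemma game_large_sets (R : realType) (hf : bool) (k : nat) :
  0 <= frac_game_value R (large_sets k) hf <= 5.
Proof.
rewrite (le_trans (tau_frac_ge0 R _) (tau_frac_le_game R _ hf)) /=.
have T2 := tau_frac_large_sets R k.
have : frac_game_value R (large_sets k) hf
    < 2 * tau_frac (large_sets k) R + (~~ hf)%:R.
  apply: game_lt_tau_frac => _ /setP/(_ [set: _]%SET).
  by rewrite !inE cardsT card_ord; lia.
have : (~~ hf)%:R <= 1 :> R by case: hf.
by lra.
Qed.

Lemma unbounded_ratio (R : realType) (hf : bool)
    (F : forall V : finType, hypergraph V -> nat) :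
  (forall (V : finType) (H : hypergraph V), (tau H <= F V H)%N) ->
  ~ (exists C : R, forall (V : finType) (H : hypergraph V),
       (F V H)%:R <= C * frac_game_value R H hf).
Proof.
move=> tauF [C FC]; pose k := Num.bound (`|C| * 5).
have /andP[g0 g5] := game_large_sets R hf k.
have : `|C| * 5 < k%:R by apply: archi_boundP; rewrite mulr_ge0.
apply/negP; rewrite -leNgt.
have kF : k%:R <= (F _ (large_sets k))%:R :> R.
  rewrite ler_nat (leq_trans _ (tauF _ _))//.
  by rewrite ltnW// ltnW// tau_large_sets.
apply: le_trans kF _; apply: le_trans (FC _ _) _.
by apply: le_trans (ler_norm _) _; rewrite normrM (ger0_norm g0) ler_wpM2l.
Qed.

Theorem proposition2 (R : realType) :
  (forall (V : finType) (H : hypergraph V),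
     [/\ tau_frac H R <= tau_frac_game H R,
         edges H <> finset.set0 -> tau_frac_game H R < 2 * tau_frac H R,
         tau_frac H R <= tau_frac_game' H R &
         tau_frac_game' H R < 2 * tau_frac H R + 1])
  /\
  [/\ ~ (exists C : R, forall (V : finType) (H : hypergraph V),
           (tau_game H)%:R <= C * tau_frac_game H R),
      ~ (exists C : R, forall (V : finType) (H : hypergraph V),
           (tau H)%:R <= C * tau_frac_game H R),
      ~ (exists C : R, forall (V : finType) (H : hypergraph V),
           (tau_game H)%:R <= C * tau_frac_game' H R) &
      ~ (exists C : R, forall (V : finType) (H : hypergraph V),
           (tau H)%:R <= C * tau_frac_game' H R)].
Proof.
split=> [V H|].
  split; try exact: tau_frac_le_game.
    by move=> ne; rewrite -[ltRHS]addr0; exact: (game_lt_tau_frac R H true).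
  exact: (game_lt_tau_frac R H false).
by split; apply: unbounded_ratio => // V H; exact: tau_le_tau_game.
Qed.
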